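(* Let $M$ be a Riemannian manifold with curvature tensor $R$, let $S$ be a symmetric $(1,1)$-tensor on $M$, and let $\theta$ be the $1$-form on $M$ associated with $S$ as defined in the context. Then $$ \operatorname{div}\theta=\langle T,S\rangle+|\operatorname{div} S|^2-|\nabla S|^2+\frac{1}{2}|W|^2, $$ where $T(X)=-\operatorname{trace}(RS)(\cdot,X,\cdot)$ and $W(X,Y)=(\nabla_XS)Y-(\nabla_YS)X$.
   Context: Let $g=\langle\cdot,\cdot\rangle$ be the metric of $M$, $g^*$ its dual, $\nabla$ the Levi-Civita connection and $R(X,Y)Z=[\nabla_X,\nabla_Y]Z-\nabla_{[X,Y]}Z$. Define the $4$-tensor $Q(X,Y,Z,W)=\langle Y,Z\rangle\langle X,W\rangle-\langle X,Z\rangle\langle Y,W\rangle$ and $\sigma_{24}(X,Y,Z,W)=(X,W,Z,Y)$. The $1$-form $\theta$ is the contraction $C((Q\circ\sigma_{24})\otimes g^{*},\nabla S\otimes S)$, which in local coordinates means $$\theta^i=Q^{jikl}(\nabla_jS_l^a)S_{ak},\qquad Q^{jikl}=g^{ik}g^{jl}-g^{jk}g^{il};$$ equivalently, for a local orthonormal frame $\{e_j\}$, $\theta(X)=\langle\operatorname{div}S,SX\rangle-\sum_j\langle(\nabla_{e_j}S)X,Se_j\rangle$. Here $\operatorname{div}S=\operatorname{trace}\nabla S=\sum_i(\nabla_{e_i}S)e_i$ (a vector field), $\operatorname{div}\theta=\nabla_i\theta^i$, and $(RS)(X,Y,Z)=R(X,Y)SZ-S(R(X,Y)Z)$, so $T(X)=-\sum_i(RS)(e_i,X,e_i)$.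 Also $\langle T,S\rangle=\sum_i\langle Te_i,Se_i\rangle$, $|\nabla S|^2=\sum_{i,j}|(\nabla_{e_i}S)e_j|^2$, $|W|^2=\sum_{i,j}|W(e_i,e_j)|^2$. *)

(* Defs.v *)
From HB Require Import structures.
From mathcomp Require Import all_boot all_order all_algebra.
From mathcomp Require Import all_classical all_reals all_analysis.
From mathcomp Require Import lra.

Set Implicit Arguments.
Unset Strict Implicit.
Unset Printing Implicit Defensive.

Import Order.TTheory GRing.Theory Num.Theory.
Import numFieldNormedType.Exports.

Local Open Scope classical_set_scope.
Local Open Scope ring_scope.

(* Conventions. Vectors are rows: a linear map f acts by v |-> v *m A, so that
   A l a is the component A_l^a, and the differential of f at x acts by
   v |-> v *m jacobian f x, as in the library. *)

Section Calculus.
Context {R : realType} {n : nat}.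
Implicit Types (D : set 'rV[R]_n) (f : 'rV[R]_n -> R).

Definition evec (i : 'I_n) : 'rV[R]_n := delta_mx 0 i.

Definition pd (i : 'I_n) f : 'rV[R]_n -> R := fun x => 'D_(evec i) f x.

(* Meant for open D: all partial derivatives of f of order at most k exist and
   are continuous on D. *)
Fixpoint Ck (k : nat) D f : Prop :=
  (forall x, D x -> {for x, continuous f}) /\
  if k is k'.+1 then
    forall i, (forall x, D x -> derivable f x (evec i)) /\ Ck k' D (pd i f)
  else True.

Definition smooth D f : Prop := forall k, Ck k D f.

Definition smooth_mx m p D (F : 'rV[R]_n -> 'M[R]_(m, p)) : Prop :=
  forall i j, smooth D (fun x => F x i j).

End Calculus.

(* A smooth n-manifold, given by a smooth atlas indexed by the type chart;
   [chart_map c] and [chart_inv c] are meaningful on [chart_dom c] and on its image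
   only. *)
Record manifold (R : realType) (n : nat) := Manifold {
  carrier :> topologicalType;
  manifold_hausdorff : hausdorff_space carrier;
  manifold_second_countable : @second_countable carrier;
  chart : Type;
  chart_dom : chart -> set carrier;
  chart_map : chart -> carrier -> 'rV[R]_n;
  chart_inv : chart -> 'rV[R]_n -> carrier;
  chart_cover : forall p, exists c, chart_dom c p;
  chart_dom_open : forall c, open (chart_dom c);
  chart_img_open : forall c, open (chart_map c @` chart_dom c);
  chart_mapK : forall c p, chart_dom c p -> chart_inv c (chart_map c p) = p;
  chart_map_continuous : forall c, {within chart_dom c, continuous (chart_map c)};
  chart_inv_continuous : forall c,
    {within chart_map c @` chart_dom c, continuous (chart_inv c)};
  transition_smooth : forall c d,
    smooth_mx (chart_map c @` (chart_dom c `&` chart_dom d))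
              (fun x => chart_map d (chart_inv c x))
}.

Section Tensors.
Context {R : realType} {n : nat}.
Implicit Type M : manifold R n.

Definition chart_img M (c : chart M) : set 'rV[R]_n := chart_map c @` chart_dom c.

Definition overlap M (c d : chart M) : set 'rV[R]_n :=
  chart_map c @` (chart_dom c `&` chart_dom d).

Definition transition M (c d : chart M) : 'rV[R]_n -> 'rV[R]_n :=
  fun x => chart_map d (chart_inv c x).

(* Tensor fields are families of component matrices, one for each chart, as
   functions of the coordinates, related by the transformation law. *)
Record riemannian_metric M := RiemannianMetric {
  metric :> chart M -> 'rV[R]_n -> 'M[R]_n;
  metric_smooth : forall c, smooth_mx (chart_img c) (metric c);
  metric_sym : forall c x, chart_img c x -> (metric c x)^T = metric c x;
  metric_pos : forall c x (v : 'rV[R]_n), chart_img c x -> v != 0 ->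
    0 < (v *m metric c x *m v^T) 0 0;
  metric_transform : forall c d x, overlap c d x ->
    let J := jacobian (transition c d) x in
    metric c x = J *m metric d (transition c d x) *m J^T
}.

Record tensor11 M := Tensor11 {
  tensor11_comp :> chart M -> 'rV[R]_n -> 'M[R]_n;
  tensor11_smooth : forall c, smooth_mx (chart_img c) (tensor11_comp c);
  tensor11_transform : forall c d x, overlap c d x ->
    let J := jacobian (transition c d) x in
    tensor11_comp c x *m J = J *m tensor11_comp d (transition c d x)
}.

End Tensors.

(* Tensor calculus in a chart: G is the matrix of metric components, S the
   matrix of components of a (1,1)-tensor, and vector fields are given by their
   components. *)
Section Local.
Context {R : realType} {n : nat}.
Local Notation vfield := ('rV[R]_n -> 'rV[R]_n).
Implicit Types (G S : 'rV[R]_n -> 'M[R]_n) (X Y Z : vfield).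
Implicit Types (e : 'I_n -> vfield) (D : set 'rV[R]_n).

Definition inner G (x u v : 'rV[R]_n) : R := (u *m G x *m v^T) 0 0.

Definition normsq G (x u : 'rV[R]_n) : R := inner G x u u.

Definition coord_field (i : 'I_n) : vfield := fun=> evec i.

Definition app S X : vfield := fun x => X x *m S x.

Definition bracket X Y : vfield := fun x => \row_k
  \sum_i (X x 0 i * pd i (fun y => Y y 0 k) x
          - Y x 0 i * pd i (fun y => X y 0 k) x).

(* Gamma^k_{ij} *)
Definition christoffel G (k i j : 'I_n) : 'rV[R]_n -> R := fun x =>
  2^-1 * \sum_l invmx (G x) k l *
    (pd i (fun y => G y j l) x + pd j (fun y => G y i l) x
     - pd l (fun y => G y i j) x).

(* The Levi-Civita connection; see christoffel_torsion_free and
   christoffel_metric below. *)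
Definition nabla G X Y : vfield := fun x => \row_k
  (\sum_i X x 0 i * pd i (fun y => Y y 0 k) x
   + \sum_i \sum_j christoffel G k i j x * X x 0 i * Y x 0 j).

Definition riem G X Y Z : vfield := fun x =>
  nabla G X (nabla G Y Z) x - nabla G Y (nabla G X Z) x
  - nabla G (bracket X Y) Z x.

(* (nabla_X S) Y *)
Definition nablaS G S X Y : vfield := fun x =>
  nabla G X (app S Y) x - app S (nabla G X Y) x.

(* The components Q^{jikl}, (nabla_j S)_l^a and S_{ak}. *)
Definition Qten G (j i k l : 'I_n) : 'rV[R]_n -> R := fun x =>
  invmx (G x) i k * invmx (G x) j l - invmx (G x) j k * invmx (G x) i l.

Definition nablaS_comp G S (j l a : 'I_n) : 'rV[R]_n -> R := fun x =>
  nablaS G S (coord_field j) (coord_field l) x 0 a.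

Definition lowerS G S (a k : 'I_n) : 'rV[R]_n -> R := fun x =>
  \sum_b G x a b * S x k b.

(* The components theta^i, i.e. the 1-form theta with its index raised. *)
Definition theta G S : vfield := fun x => \row_i
  \sum_j \sum_k \sum_l \sum_a
    Qten G j i k l x * nablaS_comp G S j l a x * lowerS G S a k x.

(* nabla_i X^i *)
Definition vdiv G X : 'rV[R]_n -> R := fun x =>
  \sum_i nabla G (coord_field i) X x 0 i.

Definition symmetric_op G S D : Prop := forall x, D x -> forall u v,
  inner G x (u *m S x) v = inner G x u (v *m S x).

Definition orthonormal_frame G D e : Prop :=
  (forall i, smooth_mx D (e i)) /\
  (forall x, D x -> forall i j, inner G x (e i x) (e j x) = (i == j)%:R).

(* The traces and norms below are taken in the orthonormal frame e. *)
Definition divS G S e : vfield := fun x =>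
  \sum_i nablaS G S (e i) (e i) x.

Definition RS G S X Y Z : vfield := fun x =>
  riem G X Y (app S Z) x - app S (riem G X Y Z) x.

Definition Top G S e X : vfield := fun x => - \sum_i RS G S (e i) X (e i) x.

Definition Wten G S X Y : vfield := fun x =>
  nablaS G S X Y x - nablaS G S Y X x.

Definition inner_TS G S e : 'rV[R]_n -> R := fun x =>
  \sum_i inner G x (Top G S e (e i) x) (app S (e i) x).

Definition normsq_nablaS G S e : 'rV[R]_n -> R := fun x =>
  \sum_i \sum_j normsq G x (nablaS G S (e i) (e j) x).

Definition normsq_W G S e : 'rV[R]_n -> R := fun x =>
  \sum_i \sum_j normsq G x (Wten G S (e i) (e j) x).

Lemma pd_metric_sym G (x : 'rV[R]_n) k i j :
  (\forall y \near x, (G y)^T = G y) ->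
  pd k (fun y => G y i j) x = pd k (fun y => G y j i) x.
Proof.
move=> Gsym; apply: near_eq_derive.
by apply: filterS Gsym => y Gy; rewrite -{1}Gy mxE.
Qed.

Lemma christoffel_torsion_free G (x : 'rV[R]_n) k i j :
  (\forall y \near x, (G y)^T = G y) ->
  christoffel G k i j x = christoffel G k j i x.
Proof.
move=> Gsym; congr (_ * _); apply: eq_bigr => l _; congr (_ * _).
by rewrite [X in X - _]addrC (@pd_metric_sym G x l i j).
Qed.

Lemma christoffel_metric G (x : 'rV[R]_n) k i j :
  (\forall y \near x, (G y)^T = G y) -> G x \in unitmx ->
  pd k (fun y => G y i j) x =
  \sum_l (christoffel G l k i x * G x l j + christoffel G l k j x * G x i l).
Proof.
move=> Gsym Gunit.
have GC a b : G x a b = G x b a.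
  by have /matrixP/(_ b a) := nbhs_singleton Gsym; rewrite mxE.
have low a b c : \sum_l christoffel G l a b x * G x l c = 2^-1 *
    (pd a (fun y => G y b c) x + pd b (fun y => G y a c) x
     - pd c (fun y => G y a b) x).
  under eq_bigr do rewrite /christoffel -mulrA mulr_suml.
  rewrite -mulr_sumr; congr (_ * _); rewrite exchange_big /=.
  rewrite (bigD1 c) //= [X in _ + X]big1 ?addr0 => [|m mc].
    under eq_bigr do rewrite mulrAC.
    rewrite -mulr_suml; under eq_bigr do rewrite mulrC GC.
    have /matrixP/(_ c c) := mulmxV Gunit.
    by rewrite !mxE eqxx => ->; rewrite mul1r.
  under eq_bigr do rewrite mulrAC.
  rewrite -mulr_suml; under eq_bigr do rewrite mulrC GC.
  have /matrixP/(_ c m) := mulmxV Gunit.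
  by rewrite !mxE eq_sym (negbTE mc) => ->; rewrite mul0r.
rewrite big_split /= low; under [X in _ + X]eq_bigr do rewrite GC.
by rewrite low (@pd_metric_sym G x k j i) //; lra.
Qed.

End Local.

(* Main.v *)
(* In a chart write A_i for the connection matrices, H = g^-1, N_i = nabla_i S
   and P_ij = nabla_i nabla_j S, without the Christoffel term of the index j.
   As S and all N_i are self-adjoint, theta is the H-trace of the commutators,
   theta = sum_j H_j [N_j, S], and the Leibniz rule together with nabla H = 0 gives
   div theta = sum_ij (H (P_ij S + N_j N_i - N_i N_j - S P_ij))_ji.
   By self-adjointness the second-order part is sum_ij (H (P_ij - P_ji) S)_ji,
   which is <T, S> by the Ricci identity (RS)(X, Y) Z = X^i Y^j Z (P_ij - P_ji);
   the first quadratic term is |div S|^2, and the second is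
   sum_kl <(nabla_k S) e_l, (nabla_l S) e_k> = |nabla S|^2 - |W|^2 / 2. Frame sums
   turn into H through sum_k e_k^T e_k = H. *)
Require Import Defs.
From mathcomp Require Import all_boot all_order all_algebra.
From mathcomp Require Import all_classical all_reals all_analysis.
From mathcomp Require Import lra ring.
Import Order.TTheory GRing.Theory Num.Theory.
Import numFieldNormedType.Exports.
Local Open Scope classical_set_scope.
Local Open Scope ring_scope.
Set Implicit Arguments.
Unset Strict Implicit.
Unset Printing Implicit Defensive.

(** * Differentiation of matrix-valued functions *)

Section MatrixDerivative.
Context {R : realType} {V : normedModType R}.
Implicit Types (x v : V).

Lemma is_derive_mxP m p (F : V -> 'M[R]_(m, p)) x v (dF : 'M[R]_(m, p)) :
  (forall i j, is_derive x v (fun y => F y i j) (dF i j)) ->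
  is_derive x v F dF.
Proof.
move=> dFij; have Fv : derivable F x v.
  by apply/derivable_mxP => i j; case: (dFij i j).
split=> //; rewrite derive_mx//; apply/matrixP => i j; rewrite mxE.
by case: (dFij i j).
Qed.

Lemma is_derive_entry m p (F : V -> 'M[R]_(m, p)) x v (dF : 'M[R]_(m, p)) i j :
  is_derive x v F dF -> is_derive x v (fun y => F y i j) (dF i j).
Proof.
case=> Fv <-; split; first by move/derivable_mxP: Fv; apply.
by rewrite derive_mx// mxE.
Qed.

Lemma is_derive_bigsum (W : normedModType R) (I : Type) (r : seq I) (P : pred I)
    (F : I -> V -> W) (dF : I -> W) x v :
  (forall i, P i -> is_derive x v (F i) (dF i)) ->
  is_derive x v (fun y => \sum_(i <- r | P i) F i y) (\sum_(i <- r | P i) dF i).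
Proof.
move=> dFi; pose s := \sum_(i <- r | P i) F i.
rewrite (_ : (fun y => _) = s); last first.
  apply/funext => y.
  by apply: (big_ind2 (fun a f => a = f y)) => // a f b h -> ->.
rewrite /s; elim/big_rec2 : _ => [|i y f Pi df]; first exact: is_derive_cst.
by have := dFi i Pi => dfi; apply: is_deriveD.
Qed.

Lemma is_derive_mul (f g : V -> R) x v df dg :
  is_derive x v f df -> is_derive x v g dg ->
  is_derive x v (fun y => f y * g y) (df * g x + f x * dg).
Proof.
move=> dfx dgx; apply: (@is_derive_eq _ _ _ (f * g)).
by rewrite addrC; congr (_ + _); rewrite mulrC.
Qed.

Lemma is_derive_mulmx m p q (F : V -> 'M[R]_(m, p)) (K : V -> 'M[R]_(p, q))
    x v dF dK :
  is_derive x v F dF -> is_derive x v K dK ->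
  is_derive x v (fun y => F y *m K y) (dF *m K x + F x *m dK).
Proof.
move=> dFx dKx; apply: is_derive_mxP => i j; rewrite !mxE -big_split/=.
rewrite (_ : (fun y => _) = fun y => \sum_k F y i k * K y k j); last first.
  by apply/funext => y; rewrite mxE.
apply: is_derive_bigsum => k _.
by apply: is_derive_mul; apply: is_derive_entry.
Qed.

Lemma is_derive_scalemx m p (f : V -> R) (F : V -> 'M[R]_(m, p)) x v df dF :
  is_derive x v f df -> is_derive x v F dF ->
  is_derive x v (fun y => f y *: F y) (df *: F x + f x *: dF).
Proof.
move=> dfx dFx; apply: is_derive_mxP => i j; rewrite !mxE.
rewrite (_ : (fun y => _) = fun y => f y * F y i j); last first.
  by apply/funext => y; rewrite mxE.
by apply: is_derive_mul => //; apply: is_derive_entry.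
Qed.

Lemma is_derive_trmx m p (F : V -> 'M[R]_(m, p)) x v dF :
  is_derive x v F dF -> is_derive x v (fun y => (F y)^T) dF^T.
Proof.
move=> dFx; apply: is_derive_mxP => i j; rewrite mxE.
rewrite (_ : (fun y => _) = fun y => F y j i); first exact: is_derive_entry.
by apply/funext => y; rewrite mxE.
Qed.

Lemma derivable_prod (I : Type) (r : seq I) (P : pred I) (F : I -> V -> R) x v :
  (forall i, P i -> derivable (F i) x v) ->
  derivable (fun y => \prod_(i <- r | P i) F i y) x v.
Proof.
move=> dFi; pose s := \prod_(i <- r | P i) F i.
rewrite (_ : (fun y => _) = s); last first.
  apply/funext => y.
  by apply: (big_ind2 (fun a f => a = f y)) => // a f b h -> ->.
rewrite /s; elim/big_rec : _ => [|i f Pi df]; first exact: derivable_cst.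
exact: derivableM (dFi i Pi) df.
Qed.

Lemma derivableMl (a : R) (f : V -> R) x v :
  derivable f x v -> derivable (fun y => a * f y) x v.
Proof. by move=> df; apply: (derivableM (derivable_cst a x v) df). Qed.

Lemma derivable_det m (F : V -> 'M[R]_m) x v :
  derivable F x v -> derivable (fun y => \det (F y)) x v.
Proof.
move=> /derivable_mxP dF.
apply: ex_derive; apply: is_derive_bigsum => s _; apply: derivableP.
by apply: derivableMl; apply: derivable_prod => i _; apply: dF.
Qed.

(** By Cramer's rule the entries are cofactors divided by the determinant. As [invmx] returns its
    argument at a singular matrix, the rule is applied on a neighbourhood of invertible values. *)
Lemma derivable_invmx m (F : V -> 'M[R]_m) x v :
  (\forall y \near x, F y \in unitmx) -> derivable F x v ->
  derivable (fun y => invmx (F y)) x v.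
Proof.
move=> Funit dF; apply/derivable_mxP => i j.
apply: (@near_eq_derivable _ _ _
  (fun y => (\det (F y))^-1 * cofactor (F y) j i)).
  by apply: filterS Funit => y; rewrite /invmx => ->; rewrite !mxE.
apply: (@derivableM _ _ (fun y => (\det (F y))^-1)).
  apply: derivableV; last exact: derivable_det.
  by have := nbhs_singleton Funit; rewrite unitmxE unitfE.
apply: derivableMl; apply: derivable_det; apply/derivable_mxP => k l.
rewrite (_ : (fun y => _) = fun y => F y (lift j k) (lift i l)).
  by move/derivable_mxP : dF; apply.
by apply/funext => y; rewrite !mxE.
Qed.

End MatrixDerivative.

(** * Algebraic identities behind curvature and self-adjointness *)

Section Algebra.
Context {R : comPzRingType} {V : lmodType R}.

Lemma scale_leibniz (a b c : R) (u v : V) :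
  a *: (b *: u + c *: v) = (a * c) *: v + (a * b) *: u.
Proof. by rewrite scalerDr !scalerA addrC. Qed.

(** Bookkeeping for the curvature: [c] and [cc] stand for the first and second covariant derivatives
    of a field Z, [dX] and [dY] for partial derivatives of components. The bracket sum removes
    exactly the terms in [dX] and [dY]. *)
Lemma antisym_second_order (n : nat) (X Y : 'I_n -> R)
    (dX dY : 'I_n -> 'I_n -> R) (c : 'I_n -> V) (cc : 'I_n -> 'I_n -> V) :
  \sum_i \sum_j (X i * Y j) *: cc i j + \sum_i \sum_j (X i * dY i j) *: c j
  - (\sum_i \sum_j (Y i * X j) *: cc i j + \sum_i \sum_j (Y i * dX i j) *: c j)
  - \sum_j (\sum_i (X i * dY i j - Y i * dX i j)) *: c j
  = \sum_i \sum_j (X i * Y j) *: (cc i j - cc j i).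
Proof.
under [X in _ - X = _]eq_bigr => j _ do rewrite scaler_suml.
rewrite (exchange_big _ _ _ _ _ (fun j i => (X i * dY i j - _) *: c j))/=.
rewrite [X in _ - (X + _) - _]exchange_big/= -!big_split/= -!sumrB.
apply: eq_bigr => i _; rewrite -!big_split/= -!sumrB; apply: eq_bigr => j _.
rewrite scalerBr scalerBl (mulrC (Y j)) opprD.
move: (_ *: cc i j) (_ *: cc j i) (_ *: c j) (_ *: c j) => p q r s.
by rewrite addrACA -[_ + _ - _]addrA addrN addr0.
Qed.

End Algebra.

(** Here [D] plays the partial derivative of [B], [A] a connection matrix, and [A *m G + G *m A^T]
    the partial derivative of the metric [G]. The second hypothesis is the first one differentiated;
    solved for [D *m G], it makes both sides agree. *)
Lemma commutator_selfadjoint (R : comPzRingType) n (A B D G : 'M[R]_n) :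
  B *m G = G *m B^T ->
  D *m G + B *m (A *m G + G *m A^T) = (A *m G + G *m A^T) *m B^T + G *m D^T ->
  (D + B *m A - A *m B) *m G = G *m (D + B *m A - A *m B)^T.
Proof.
move=> BG; rewrite mulmxDr mulmxDl => /(canRL (addrK _)) DG.
have ABG : A *m B *m G = A *m G *m B^T by rewrite -!mulmxA BG.
rewrite [_^T]linearB/= [(D + _)^T]linearD/= mulmxBr mulmxDr mulmxBl mulmxDl.
rewrite DG ABG.
rewrite !trmx_mul !mulmxA -BG.
move: (A *m G *m _) (G *m A^T *m _) (G *m D^T) (B *m A *m G) (B *m G *m _).
by move=> a b c d e; apply/matrixP => u v; rewrite !mxE; ring.
Qed.

(** For [p], [q] the two second covariant derivatives of [z], and [a], [b] the mixed Leibniz terms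
    of [z *m S]: changing the order of differentiation swaps [a] and [b], so they cancel. *)
Lemma antisym_leibniz (R : comPzRingType) m n (p q : 'M[R]_(m, n)) (S : 'M[R]_n)
    (a b z : 'M[R]_(m, n)) (P Q : 'M[R]_n) :
  p *m S + a + (b + z *m P) - (q *m S + b + (a + z *m Q)) - (p - q) *m S
  = z *m (P - Q).
Proof.
rewrite mulmxBl mulmxBr.
move: (p *m S) (q *m S) (z *m P) (z *m Q) => c d f h.
by apply/matrixP => u v; rewrite !mxE; ring.
Qed.

(** * Differentiability at a point, to first and second order *)

Section Smoothness.
Context {R : realType} {n : nat}.
Local Notation vec := 'rV[R]_n.
Implicit Types (x y : vec) (D : set vec).

Definition diff1 m p (F : vec -> 'M[R]_(m, p)) x :=
  forall i, derivable F x (evec i).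

(** First partials are asked for near [x], so that their own derivatives at [x] can be taken through
    identities valid near [x]. *)
Definition diff2 m p (F : vec -> 'M[R]_(m, p)) x :=
  (\forall y \near x, diff1 F y) /\ forall j, diff1 ('D_(evec j) F) x.

Lemma diff2W m p (F : vec -> 'M[R]_(m, p)) x : diff2 F x -> diff1 F x.
Proof. by case=> /nbhs_singleton. Qed.

Lemma smooth_diff2 m p (F : vec -> 'M[R]_(m, p)) D x :
  open D -> D x -> smooth_mx D F -> diff2 F x.
Proof.
move=> Dopen Dx sF.
have F1 y : D y -> diff1 F y.
  move=> Dy i; apply/derivable_mxP => a b.
  by have [_ /(_ i)[/(_ y Dy)]] := sF a b 1%N.
have nD : \forall y \near x, D y by apply: open_nbhs_nbhs.
split=> [|j i]; first exact: filterS nD.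
(* The derivative of [F] is the matrix of entrywise partials where [F] is derivable, hence on [D];
   derivability passes through this local equality. *)
apply: (@near_eq_derivable _ _ _
  (fun y => \matrix_(a, b) pd j (fun z => F z a b) y)).
  by apply: filterS nD => y Dy; rewrite /= derive_mx//; exact: F1.
apply/derivable_mxP => a b.
rewrite (_ : (fun y => _) = pd j (fun z => F z a b)); last first.
  by apply/funext => y; rewrite mxE.
by have [_ /(_ j)[_ [_ /(_ i)[/(_ x Dx)]]]] := sF a b 2%N.
Qed.

Lemma diff1_near m p (F K : vec -> 'M[R]_(m, p)) x :
  (\forall y \near x, F y = K y) -> diff1 F x -> diff1 K x.
Proof. by move=> FK dF i; apply: near_eq_derivable (dF i). Qed.

Lemma diff1_mulmx m p q (F : vec -> 'M[R]_(m, p)) (K : vec -> 'M[R]_(p, q)) x :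
  diff1 F x -> diff1 K x -> diff1 (fun y => F y *m K y) x.
Proof.
move=> dF dK i; apply: ex_derive.
by apply: is_derive_mulmx; apply: derivableP.
Qed.

Lemma diff1D m p (F K : vec -> 'M[R]_(m, p)) x :
  diff1 F x -> diff1 K x -> diff1 (fun y => F y + K y) x.
Proof. by move=> dF dK i; apply: derivableD. Qed.

Lemma diff1B m p (F K : vec -> 'M[R]_(m, p)) x :
  diff1 F x -> diff1 K x -> diff1 (fun y => F y - K y) x.
Proof. by move=> dF dK i; apply: derivableB. Qed.

End Smoothness.

(** * Covariant derivatives in a chart, curvature and the Ricci identity *)

Section Covariant.
Context {R : realType} {n : nat}.
Local Notation vec := 'rV[R]_n.
Implicit Types (x y : vec) (D : set vec) (G S B C : vec -> 'M[R]_n).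
Implicit Types (X Y Z : vec -> vec).

(* Matrix of the connection form: row vectors Y have
   nabla_i Y = d_i Y + Y *m conn G i. *)
Definition conn G (i : 'I_n) x : 'M[R]_n := \matrix_(j, k) christoffel G k i j x.

Definition cov_vec G i Y x : vec := 'D_(evec i) Y x + Y x *m conn G i x.

(** Matrices act on rows from the right, so the connection enters as a commutator. For
    [B := cov_end G j S] the index [j] is a mere label, which is why no Christoffel term of [j]
    arises on iteration. *)
Definition cov_end G i B x : 'M[R]_n :=
  'D_(evec i) B x + B x *m conn G i x - conn G i x *m B x.

Lemma diff1_conn G x i :
  (\forall y \near x, G y \in unitmx) -> diff2 G x -> diff1 (conn G i) x.
Proof.
move=> Gunit [G1 G2] l; apply/derivable_mxP => j k.
rewrite (_ : (fun y => _) = christoffel G k i j); last first.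
  by apply/funext => y; rewrite mxE.
have d2 a b c : derivable (pd a (fun y => G y b c)) x (evec l).
  apply: (@near_eq_derivable _ _ _ (fun y => 'D_(evec a) G y b c)).
    by apply: filterS G1 => y Gy; rewrite derive_mx// mxE.
  by have /derivable_mxP := G2 a l; apply.
apply: derivableMl; apply: ex_derive; apply: is_derive_bigsum => q _.
apply: derivableP; apply: (@derivableM _ _ (fun y => invmx (G y) k q)).
  have /derivable_mxP := derivable_invmx Gunit ((nbhs_singleton G1) l).
  by apply.
by apply: (@derivableB _ _ _ (fun y => _ + _)); [apply: derivableD|].
Qed.

Lemma nablaE G X Y x : diff1 Y x ->
  nabla G X Y x = \sum_i X x 0 i *: cov_vec G i Y x.
Proof.
move=> Y1; apply/rowP => k; rewrite mxE summxE -big_split/=.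
apply: eq_bigr => i _; rewrite !mxE mulrDr derive_mx// !mxE.
congr (_ + _); rewrite mulr_sumr; apply: eq_bigr => j _.
by rewrite !mxE; ring.
Qed.

Lemma cov_vec_near G i Y Z x : (\forall y \near x, Y y = Z y) ->
  cov_vec G i Y x = cov_vec G i Z x.
Proof.
by move=> YZ; rewrite /cov_vec (near_eq_derive _ YZ) (nbhs_singleton YZ).
Qed.

Lemma cov_vec_scale G i (f : vec -> R) Y x :
  derivable f x (evec i) -> derivable Y x (evec i) ->
  cov_vec G i (fun y => f y *: Y y) x =
  pd i f x *: Y x + f x *: cov_vec G i Y x.
Proof.
move=> /derivableP df /derivableP dY.
rewrite /cov_vec; have [_ ->] := is_derive_scalemx df dY.
by rewrite scalerDr -scalemxAl addrA.
Qed.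

Lemma cov_vec_sum G i (I : finType) (Y : I -> vec -> vec) x :
  (forall j, derivable (Y j) x (evec i)) ->
  cov_vec G i (fun y => \sum_j Y j y) x = \sum_j cov_vec G i (Y j) x.
Proof.
move=> dY; rewrite /cov_vec.
have [|_ ->] := @is_derive_bigsum _ _ _ _ (index_enum I) predT Y
  (fun j => 'D_(evec i) (Y j) x) x (evec i).
  by move=> j _; exact: derivableP.
by rewrite mulmx_suml big_split.
Qed.

Lemma cov_vec_mulmx G i Y B x :
  derivable Y x (evec i) -> derivable B x (evec i) ->
  cov_vec G i (fun y => Y y *m B y) x =
  cov_vec G i Y x *m B x + Y x *m cov_end G i B x.
Proof.
move=> /derivableP dY /derivableP dB.
rewrite /cov_vec /cov_end; have [_ ->] := is_derive_mulmx dY dB.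
rewrite mulmxBr !mulmxDr mulmxDl !mulmxA.
move: ('D_(evec i) Y x *m _) (Y x *m 'D_(evec i) B x) => a b.
move: (Y x *m B x *m _) (Y x *m _ *m B x) => p q.
by apply/rowP => u; rewrite !mxE; ring.
Qed.

Lemma cov_vecD G i Y Z x :
  derivable Y x (evec i) -> derivable Z x (evec i) ->
  cov_vec G i (fun y => Y y + Z y) x = cov_vec G i Y x + cov_vec G i Z x.
Proof. by move=> dY dZ; rewrite /cov_vec deriveD// mulmxDl addrACA. Qed.

Lemma cov_endB G i B C x :
  derivable B x (evec i) -> derivable C x (evec i) ->
  cov_end G i (fun y => B y - C y) x = cov_end G i B x - cov_end G i C x.
Proof.
move=> dB dC; rewrite /cov_end deriveB// mulmxBl mulmxBr.
move: (B x *m _) (C x *m _) (_ *m B x) (_ *m C x) => a b c d.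
by apply/matrixP => u v; rewrite !mxE; ring.
Qed.

Lemma cov_end_mulmx G i B C x :
  derivable B x (evec i) -> derivable C x (evec i) ->
  cov_end G i (fun y => B y *m C y) x =
  cov_end G i B x *m C x + B x *m cov_end G i C x.
Proof.
move=> /derivableP dB /derivableP dC.
rewrite /cov_end; have [_ ->] := is_derive_mulmx dB dC.
rewrite mulmxBr !mulmxDr mulmxBl !mulmxDl !mulmxA.
move: ('D_(evec i) B x *m _) (B x *m 'D_(evec i) C x) => a b.
move: (B x *m C x *m _) (B x *m _ *m C x) (conn G i x *m _ *m _) => p q r.
by apply/matrixP => u v; rewrite !mxE; ring.
Qed.

Lemma diff1_cov_vec G i Y x : diff2 Y x -> diff1 (conn G i) x ->
  diff1 (cov_vec G i Y) x.
Proof.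
move=> dY dA; apply: diff1D; first by case: dY => _ /(_ i).
by apply: diff1_mulmx => //; exact: diff2W.
Qed.

Lemma diff1_cov_end G i B x : diff2 B x -> diff1 (conn G i) x ->
  diff1 (cov_end G i B) x.
Proof.
move=> dB dA; have dB1 := diff2W dB.
apply: diff1B; last exact: diff1_mulmx.
by apply: diff1D; [case: dB => _ /(_ i)|exact: diff1_mulmx].
Qed.

(** Tensoriality: by the Leibniz rule the derivatives of [Y] cancel and only its value at [x]
    survives. *)
Lemma nablaSE G S X Y x : diff1 Y x -> diff1 S x ->
  nablaS G S X Y x = \sum_i X x 0 i *: (Y x *m cov_end G i S x).
Proof.
move=> dY dS; rewrite /nablaS /app.
rewrite (nablaE _ _ dY) (nablaE _ _ (diff1_mulmx dY dS)).
rewrite mulmx_suml -sumrB; apply: eq_bigr => i _.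
by rewrite cov_vec_mulmx// -scalemxAl -scalerBr addrC addKr.
Qed.

Lemma bracketE X Y x k : bracket X Y x 0 k =
  \sum_i (X x 0 i * pd i (fun y => Y y 0 k) x
          - Y x 0 i * pd i (fun y => X y 0 k) x).
Proof. by rewrite mxE. Qed.

(* Otherwise failing unifications unfold these down to entries of matrices. *)
Local Opaque bracket nabla cov_vec cov_end pd.

Lemma nabla_nablaE G X Y Z x :
  diff1 Y x -> (\forall y \near x, diff1 Z y) ->
  (forall j, diff1 (cov_vec G j Z) x) ->
  nabla G X (nabla G Y Z) x =
  \sum_i \sum_j (X x 0 i * Y x 0 j) *: cov_vec G i (cov_vec G j Z) x +
  \sum_i \sum_j (X x 0 i * pd i (fun y => Y y 0 j) x) *: cov_vec G j Z x.
Proof.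
move=> dY Z1 dZ.
(* The coordinate form of [nabla] holds where [Z] is derivable; having it near [x] suffices to
   differentiate it at [x]. *)
have YZ : \forall y \near x,
    \sum_j Y y 0 j *: cov_vec G j Z y = nabla G Y Z y.
  by apply: filterS Z1 => y dZy; rewrite nablaE.
have dYj i j : derivable (fun y => Y y 0 j) x (evec i).
  by have /derivable_mxP := dY i; apply.
have dYZ i j : derivable (fun y => Y y 0 j *: cov_vec G j Z y) x (evec i).
  apply: ex_derive; apply: is_derive_scalemx; apply: derivableP => //.
  exact: dZ.
rewrite nablaE; last first.
  apply: diff1_near YZ _ => i; apply: ex_derive; apply: is_derive_bigsum => j _.
  exact: derivableP.
rewrite -big_split/=; apply: eq_bigr => i _.
have -> : cov_vec G i (nabla G Y Z) x =
    \sum_j cov_vec G i (fun y => Y y 0 j *: cov_vec G j Z y) x.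
  rewrite -(cov_vec_near G i YZ).
  have := @cov_vec_sum G i 'I_n (fun j y => Y y 0 j *: cov_vec G j Z y) x.
  by apply=> j; exact: dYZ.
rewrite scaler_sumr -big_split/=.
apply: eq_bigr => j _; rewrite cov_vec_scale//; last exact: dZ.
exact: scale_leibniz.
Qed.

Lemma riemE G X Y Z x :
  diff1 X x -> diff1 Y x -> (\forall y \near x, diff1 Z y) ->
  (forall j, diff1 (cov_vec G j Z) x) ->
  riem G X Y Z x = \sum_i \sum_j (X x 0 i * Y x 0 j) *:
    (cov_vec G i (cov_vec G j Z) x - cov_vec G j (cov_vec G i Z) x).
Proof.
move=> dX dY Z1 dZ; rewrite /riem.
rewrite (nabla_nablaE X dY Z1 dZ) (nabla_nablaE Y dX Z1 dZ).
rewrite (nablaE _ _ (nbhs_singleton Z1)).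
under [X in _ - X = _]eq_bigr => j _ do rewrite bracketE.
exact: antisym_second_order.
Qed.

(* The second derivatives of Z cancel between the two curvature terms, so no
   symmetry of second derivatives is needed. *)
Lemma RSE G S X Y Z x (P := fun i j => cov_end G i (cov_end G j S) x) :
  diff1 X x -> diff1 Y x -> diff2 Z x -> diff2 S x ->
  (forall i, diff1 (conn G i) x) ->
  RS G S X Y Z x = \sum_i \sum_j (X x 0 i * Y x 0 j) *:
    (Z x *m (P i j - P j i)).
Proof.
move=> dX dY dZ dS dA.
have dZ1 := diff2W dZ; have dS1 := diff2W dS.
have dcZ j : diff1 (cov_vec G j Z) x by exact: diff1_cov_vec dZ (dA j).
have dcS j : diff1 (cov_end G j S) x by exact: diff1_cov_end dS (dA j).
have cZS j : \forall y \near x,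
    cov_vec G j Z y *m S y + Z y *m cov_end G j S y = cov_vec G j (app S Z) y.
  case: dZ dS => dZ _ [dS _]; near=> y.
  have [dZy dSy] : diff1 Z y /\ diff1 S y by split; near: y.
  by rewrite (cov_vec_mulmx G (dZy j) (dSy j)).
have nZS : \forall y \near x, diff1 (app S Z) y.
  case: dZ dS => dZ _ [dS _]; near=> y.
  by apply: diff1_mulmx; near: y.
have dcZS j : diff1 (cov_vec G j (app S Z)) x.
  apply: diff1_near (cZS j) _.
  exact: diff1D (diff1_mulmx (dcZ j) dS1) (diff1_mulmx dZ1 (dcS j)).
rewrite /RS (riemE dX dY nZS dcZS) [app S (riem _ _ _ _) x]/app.
rewrite (riemE dX dY dZ.1 dcZ).
have ccZS i j : cov_vec G i (cov_vec G j (app S Z)) x =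
    cov_vec G i (cov_vec G j Z) x *m S x + cov_vec G j Z x *m cov_end G i S x
    + (cov_vec G i Z x *m cov_end G j S x + Z x *m P i j).
  rewrite -(cov_vec_near _ _ (cZS j)).
  rewrite -(cov_vec_mulmx G (dcZ j i) (dS1 i)).
  rewrite -(cov_vec_mulmx G (dZ1 i) (dcS j i)).
  have dl : diff1 (fun y => cov_vec G j Z y *m S y) x.
    exact: diff1_mulmx (dcZ j) dS1.
  have dr : diff1 (fun y => Z y *m cov_end G j S y) x.
    exact: diff1_mulmx dZ1 (dcS j).
  exact: cov_vecD (dl i) (dr i).
rewrite mulmx_suml -sumrB; apply: eq_bigr => i _.
rewrite mulmx_suml -sumrB; apply: eq_bigr => j _.
rewrite -scalemxAl -[LHS]scalerBr.
have -> : cov_vec G i (cov_vec G j (app S Z)) x -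
    cov_vec G j (cov_vec G i (app S Z)) x -
    (cov_vec G i (cov_vec G j Z) x - cov_vec G j (cov_vec G i Z) x) *m S x =
    Z x *m (P i j - P j i); last by [].
rewrite (ccZS i j) (ccZS j i).
exact: antisym_leibniz.
Unshelve. all: by end_near. Qed.

Local Transparent cov_end.

(** Matrix form of metric compatibility: entry by entry this is [christoffel_metric]. *)
Lemma derive_metric G k x :
  (\forall y \near x, (G y)^T = G y) -> G x \in unitmx -> diff1 G x ->
  'D_(evec k) G x = conn G k x *m G x + G x *m (conn G k x)^T.
Proof.
move=> Gsym Gunit dG; apply/matrixP => i j.
rewrite derive_mx// [LHS]mxE -/(pd k _) [LHS]christoffel_metric// !mxE.
rewrite -big_split/=.
by apply: eq_bigr => l _; rewrite !mxE; congr (_ + _); rewrite mulrC.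
Qed.

(** Differentiate G G^-1 = 1, which holds near [x], and solve for the derivative of the inverse. *)
Lemma derive_metric_inv G k x :
  (\forall y \near x, (G y)^T = G y) -> (\forall y \near x, G y \in unitmx) ->
  diff1 G x ->
  'D_(evec k) (fun y => invmx (G y)) x =
    - ((conn G k x)^T *m invmx (G x) + invmx (G x) *m conn G k x).
Proof.
move=> Gsym Gunit dG; have Gx := nbhs_singleton Gunit.
have dH : derivable (fun y => invmx (G y)) x (evec k) by exact: derivable_invmx.
have [_] := is_derive_mulmx (derivableP (dG k)) (derivableP dH).
have -> : 'D_(evec k) (fun y => G y *m invmx (G y)) x = 0.
  rewrite -(derive_cst (1%:M : 'M[R]_n) x (evec k)).
  by apply: near_eq_derive; apply: filterS Gunit => y Gy; rewrite mulmxV.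
move/(congr1 (mulmx (invmx (G x)))); rewrite mulmx0 mulmxDr !mulmxA mulVmx//.
rewrite mul1mx derive_metric// mulmxDr !mulmxA mulVmx// mul1mx mulmxDl mulmxK//.
by move=> /esym/eqP; rewrite addrC addr_eq0 => /eqP ->; rewrite addrC.
Qed.

(** Since the metric is parallel, self-adjointness survives covariant differentiation. It is applied
    first to S and then to each nabla_j S. *)
Lemma cov_end_selfadjoint G B k x :
  (\forall y \near x, (G y)^T = G y) -> G x \in unitmx ->
  (\forall y \near x, B y *m G y = G y *m (B y)^T) ->
  diff1 G x -> diff1 B x ->
  cov_end G k B x *m G x = G x *m (cov_end G k B x)^T.
Proof.
move=> Gsym Gunit BG dG dB.
have := near_eq_derive (evec k) BG.
have [_ ->] := is_derive_mulmx (derivableP (dB k)) (derivableP (dG k)).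
have [_ ->] := is_derive_mulmx (derivableP (dG k))
  (is_derive_trmx (derivableP (dB k))).
rewrite (derive_metric k Gsym Gunit dG) /cov_end.
exact: commutator_selfadjoint (nbhs_singleton BG).
Qed.

End Covariant.

(** * Linear algebra of self-adjoint matrices and orthonormal frames *)

Section FrameAlgebra.
Context {R : realType} {n : nat}.
Implicit Types (G H N L A B C : 'M[R]_n) (e : 'I_n -> 'rV[R]_n).

Lemma selfadjoint_inv G B : G \in unitmx -> B *m G = G *m B^T ->
  invmx G *m B = B^T *m invmx G.
Proof.
by move=> Gu BG; rewrite -[LHS](mulmxK Gu) -(mulmxA _ B) BG mulKmx.
Qed.

(** With [H] the inverse metric, transposition exchanges two self-adjoint factors; in particular H
    [A, B] is skew. *)
Lemma selfadjointM_tr H A B : H^T = H ->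
  H *m A = A^T *m H -> H *m B = B^T *m H -> (H *m A *m B)^T = H *m B *m A.
Proof. by move=> Hs HA HB; rewrite !trmx_mul Hs -HA mulmxA -HB. Qed.


(** The coefficient of [N l a * L k a] is [Qten]. Its two products contract to the same matrix with
    [i] and [j] interchanged. *)
Lemma contract_skew H N L i j :
  \sum_k \sum_l \sum_a (H i k * H j l - H j k * H i l) * N l a * L k a =
  (H *m N *m (H *m L)^T) j i - (H *m N *m (H *m L)^T) i j.
Proof.
have E p q : (H *m N *m (H *m L)^T) p q =
    \sum_k \sum_l \sum_a H q k * H p l * N l a * L k a.
  rewrite mxE [RHS]exchange_big.
  rewrite [RHS](eq_bigr _ (fun l _ => exchange_big _ _ _ _ _ _))/=.
  rewrite [RHS]exchange_big/=; apply: eq_bigr => a _.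
  rewrite !mxE big_distrlr/=.
  by apply: eq_bigr => l _; apply: eq_bigr => k _; ring.
rewrite !E -sumrB; apply: eq_bigr => k _; rewrite -sumrB; apply: eq_bigr => l _.
by rewrite -sumrB; apply: eq_bigr => a _; ring.
Qed.

Lemma sym_skew0 (c K : 'I_n -> 'I_n -> R) :
  (forall i m, c i m = c m i) -> (forall i m, K i m = - K m i) ->
  \sum_i \sum_m c i m * K m i = 0.
Proof.
move=> cs Ks; set s := \sum_i _.
suff : s = - s by lra.
rewrite {1}/s exchange_big/= /s -sumrN; apply: eq_bigr => i _.
by rewrite -sumrN; apply: eq_bigr => m _; rewrite cs Ks mulrN.
Qed.

Lemma row_mul_entry A B C i j :
  (row i A *m C *m (row j B)^T) 0 0 = (A *m C *m B^T) i j.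
Proof.
by rewrite -row_mul mxE [RHS]mxE; apply: eq_bigr => k _; rewrite !mxE.
Qed.

Section Frame.
Variables (G : 'M[R]_n) (e : 'I_n -> 'rV[R]_n).
Hypothesis e_orth : forall i j, (e i *m G *m (e j)^T) 0 0 = (i == j)%:R.
Hypotheses (Gsym : G^T = G) (Gunit : G \in unitmx).

(** Let E have the frame vectors as rows. Orthonormality reads E G E^T = 1; a one-sided inverse of a
    square matrix is two-sided, so G E^T E = 1. *)
Lemma frame_inv : \sum_k (e k)^T *m e k = invmx G.
Proof.
pose E : 'M[R]_n := \matrix_k e k.
have EGE : E *m (G *m E^T) = 1%:M.
  apply/matrixP => i j; rewrite mulmxA !mxE -e_orth !mxE.
  apply: eq_bigr => k _; rewrite !mxE; congr (_ * _).
  by apply: eq_bigr => l _; rewrite !mxE.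
have := mulmx1C EGE; rewrite -mulmxA => /(congr1 (mulmx (invmx G))).
rewrite mulKmx// mulmx1 => <-; apply/matrixP => i j; rewrite summxE !mxE.
by apply: eq_bigr => k _; rewrite !mxE big_ord1 !mxE.
Qed.

Lemma frame_row i : \sum_k e k 0 i *: e k = row i (invmx G).
Proof.
rewrite -frame_inv; apply/rowP => j; rewrite !mxE !summxE.
by apply: eq_bigr => k _; rewrite !mxE big_ord1 !mxE.
Qed.

Lemma frame_sum i C : \sum_k e k 0 i *: (e k *m C) = row i (invmx G) *m C.
Proof.
by rewrite -frame_row mulmx_suml; apply: eq_bigr => k _; rewrite scalemxAl.
Qed.

End Frame.
End FrameAlgebra.

(** * The field theta and its divergence *)

Section Theta.
Context {R : realType} {n : nat}.
Local Notation vec := 'rV[R]_n.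
Variables (G S : vec -> 'M[R]_n) (D : set vec).
Hypotheses (Dopen : open D) (dG : forall y, D y -> diff2 G y).
Hypotheses (dS : forall y, D y -> diff2 S y).
Hypotheses (Gsym : forall y, D y -> (G y)^T = G y).
Hypotheses (Gunit : forall y, D y -> G y \in unitmx).
Hypotheses (SG : forall y, D y -> S y *m G y = G y *m (S y)^T).
Implicit Types (x y : vec) (i j k : 'I_n).

Local Notation H y := (invmx (G y)).
Local Notation N := (fun j => cov_end G j S).
Local Notation P := (fun i j => cov_end G i (cov_end G j S)).

Lemma near_open (Q : vec -> Prop) x :
  D x -> (forall y, D y -> Q y) -> \forall y \near x, Q y.
Proof.
move=> Dx DQ; have nD : \forall y \near x, D y by exact: open_nbhs_nbhs.
exact: filterS nD.
Qed.

Lemma diff1_conn_on i y : D y -> diff1 (conn G i) y.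
Proof. by move=> Dy; apply: diff1_conn; [exact: near_open Gunit|exact: dG]. Qed.

Lemma diff1_covS j y : D y -> diff1 (N j) y.
Proof. by move=> Dy; exact: diff1_cov_end (dS Dy) (diff1_conn_on Dy). Qed.

Lemma covS_selfadjoint j y : D y -> N j y *m G y = G y *m (N j y)^T.
Proof.
move=> Dy; apply: cov_end_selfadjoint.
- exact: near_open Gsym.
- exact: Gunit.
- exact: near_open SG.
- exact: diff2W (dG Dy).
- exact: diff2W (dS Dy).
Qed.

Lemma cov2S_selfadjoint i j y : D y -> P i j y *m G y = G y *m (P i j y)^T.
Proof.
move=> Dy; apply: cov_end_selfadjoint.
- exact: near_open Gsym.
- exact: Gunit.
- exact: near_open (covS_selfadjoint j).
- exact: diff2W (dG Dy).
- exact: diff1_covS.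
Qed.

Lemma inv_metric_sym y : D y -> (H y)^T = H y.
Proof. by move=> Dy; rewrite trmx_inv Gsym. Qed.

Lemma conn_sym i m j y : D y -> conn G i y m j = conn G m y i j.
Proof.
move=> Dy; rewrite !mxE; apply: christoffel_torsion_free.
exact: near_open Gsym.
Qed.

Lemma nablaS_coord j l a y : D y -> nablaS_comp G S j l a y = N j y l a.
Proof.
move=> Dy; rewrite /nablaS_comp nablaSE; last exact: diff2W (dS Dy).
  rewrite (bigD1 j)//= big1 => [|i ij]; last first.
    by rewrite [coord_field j y 0 i]mxE (negbTE ij) andbF scale0r.
  by rewrite [coord_field j y 0 j]mxE !eqxx scale1r addr0 -rowE mxE.
by move=> i; exact: derivable_cst.
Qed.

(** The contraction leaves (H N_j S)_ji - (H N_j S)_ij; transposing the second term by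
    self-adjointness gives (H S N_j)_ji. *)
Lemma thetaE y : D y -> theta G S y =
  \sum_j row j (H y) *m (N j y *m S y - S y *m N j y).
Proof.
move=> Dy; apply/rowP => i; rewrite mxE summxE; apply: eq_bigr => j _.
have HS := selfadjoint_inv (Gunit Dy) (SG Dy).
have HN := selfadjoint_inv (Gunit Dy) (covS_selfadjoint j Dy).
(* [L k a] is the lowered component S_ak. As H S G = S^T, the factor (H L)^T of the contraction
   collapses to S. *)
pose L := S y *m (G y)^T.
have LE a k : lowerS G S a k y = L k a.
  by rewrite /lowerS mxE; apply: eq_bigr => b _; rewrite mxE mulrC.
under eq_bigr => k _ do under eq_bigr => l _ do under eq_bigr => a _ do
  rewrite nablaS_coord// LE.
rewrite contract_skew /L Gsym// mulmxA HS mulmxKV ?Gunit// trmxK.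
rewrite -row_mul [RHS]mxE (mulmxBr _ (N j y *m S y)) !mulmxA.
have -> : (H y *m N j y *m S y) i j = (H y *m S y *m N j y) j i.
  by rewrite -(selfadjointM_tr (inv_metric_sym Dy) HN HS) [RHS]mxE.
by rewrite [RHS]mxE [X in _ = _ + X]mxE.
Qed.

Let B j y := N j y *m S y - S y *m N j y.

Lemma diff1_commutator j y : D y -> diff1 (B j) y.
Proof.
move=> Dy; have dSy := diff2W (dS Dy); have dN := @diff1_covS j y Dy.
exact: diff1B (diff1_mulmx dN dSy) (diff1_mulmx dSy dN).
Qed.

Lemma cov_commutator i j y : D y -> cov_end G i (B j) y =
  P i j y *m S y + N j y *m N i y - (N i y *m N j y + S y *m P i j y).
Proof.
move=> Dy; have dSy := diff2W (dS Dy); have dN := @diff1_covS j y Dy.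
rewrite -(cov_end_mulmx G (dN i) (dSy i)) -(cov_end_mulmx G (dSy i) (dN i)).
apply: cov_endB; first exact: diff1_mulmx.
exact: diff1_mulmx.
Qed.

(** The inverse metric is parallel in both indices. Treating row [j] as a vector corrects one index
    only, so minus the correction for [j] remains. *)
Lemma cov_inv_row i j y : D y ->
  cov_vec G i (fun z => row j (H z)) y = - (row j ((conn G i y)^T *m H y)).
Proof.
move=> Dy; have dH : derivable (fun z => H z) y (evec i).
  apply: derivable_invmx; first exact: near_open Gunit.
  exact: (diff2W (dG Dy)).
have -> : (fun z => row j (H z)) = (fun z => evec j *m H z).
  by apply/funext => z; rewrite rowE.
rewrite /cov_vec.
have [_ ->] := is_derive_mulmx (@is_derive_cst _ vec _ (@evec R n j) y (evec i))
  (derivableP dH).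
rewrite mul0mx add0r derive_metric_inv; first last.
- exact: diff2W (dG Dy).
- exact: near_open Gunit.
- exact: near_open Gsym.
by rewrite -mulmxA -mulmxDr opprD subrK mulmxN -rowE.
Qed.

Lemma vdiv_thetaE x : D x -> vdiv G (theta G S) x =
  \sum_i \sum_j (H x *m cov_end G i (B j) x) j i.
Proof.
move=> Dx.
have near_theta : \forall y \near x,
    \sum_j row j (H y) *m B j y = theta G S y.
  by apply: near_open => // y Dy; rewrite thetaE.
have drow j : diff1 (fun y => row j (H y)) x.
  move=> i; have /derivable_mxP dH : derivable (fun z => H z) x (evec i).
    apply: derivable_invmx; first exact: near_open Gunit.
    exact: (diff2W (dG Dx)).
  apply/derivable_mxP => a b.
  rewrite (_ : (fun y => _) = fun y => H y j b) //.
  by apply/funext => y; rewrite mxE.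
have dB j : diff1 (B j) x by exact: diff1_commutator.
have dterm j : diff1 (fun y => row j (H y) *m B j y) x.
  exact: diff1_mulmx (drow j) (dB j).
have dtheta : diff1 (theta G S) x.
  apply: diff1_near near_theta _ => i; apply: ex_derive.
  by apply: is_derive_bigsum => j _; apply: derivableP; exact: dterm.
(* The Christoffel terms from differentiating the row index j vanish: they
   contract the symmetric lower indices of Gamma^j with H *m B j, which is
   skew as a commutator of self-adjoint operators. *)
have skew j m i : (H x *m B j x) m i = - (H x *m B j x) i m.
  have HS := selfadjoint_inv (Gunit Dx) (SG Dx).
  have HN := selfadjoint_inv (Gunit Dx) (covS_selfadjoint j Dx).
  have Hs := inv_metric_sym Dx.
  rewrite /B mulmxBr !mulmxA -[in LHS](selfadjointM_tr Hs HS HN).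
  by rewrite -[in X in _ - X](selfadjointM_tr Hs HN HS) !mxE opprB.
(* Subtracting this vanishing sum restores the Christoffel terms, so that both sides can be matched
   for each [i] and [j]. *)
have -> : \sum_i \sum_j (H x *m cov_end G i (B j) x) j i =
    \sum_i \sum_j (H x *m cov_end G i (B j) x) j i -
    \sum_j \sum_i \sum_m conn G i x m j * (H x *m B j x) m i.
  rewrite [X in _ - X]big1 ?subr0// => j _.
  by apply: sym_skew0 => i m; [exact: conn_sym|exact: skew].
rewrite [X in _ - X]exchange_big/= -sumrB; apply: eq_bigr => i _.
rewrite (nablaE _ _ dtheta).
rewrite (bigD1 i)//= big1 => [|k ik]; last first.
  by rewrite [coord_field i x 0 k]mxE (negbTE ik) andbF scale0r.
rewrite [coord_field i x 0 i]mxE !eqxx scale1r addr0.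
rewrite -(cov_vec_near G i near_theta).
have -> : cov_vec G i (fun y => \sum_j row j (H y) *m B j y) x =
    \sum_j cov_vec G i (fun y => row j (H y) *m B j y) x.
  have := @cov_vec_sum R n G i 'I_n (fun j y => row j (H y) *m B j y) x.
  by apply=> j; exact: dterm.
rewrite summxE -sumrB; apply: eq_bigr => j _.
rewrite (cov_vec_mulmx G (drow j i) (dB j i)) cov_inv_row//.
rewrite addrC mxE; congr (_ + _); first by rewrite -row_mul mxE.
rewrite mulNmx mxE; congr (- _); rewrite -row_mul mxE -mulmxA mxE.
by apply: eq_bigr => m _; rewrite mxE.
Qed.

Lemma vdiv_theta x : D x -> vdiv G (theta G S) x =
  \sum_i \sum_j ((H x *m (P i j x - P j i x) *m S x) j i
    + (H x *m N j x *m N i x) j i - (H x *m N i x *m N j x) j i).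
Proof.
move=> Dx; rewrite vdiv_thetaE//.
have HS := selfadjoint_inv (Gunit Dx) (SG Dx).
have Hs := inv_metric_sym Dx.
(* Brings both second-order terms of the differentiated commutator to the shape H P S, at the price
   of transposed indices. *)
have HSP i j : (H x *m S x *m P i j x) j i = (H x *m P i j x *m S x) i j.
  have HP := selfadjoint_inv (Gunit Dx) (cov2S_selfadjoint i j Dx).
  by rewrite -(selfadjointM_tr Hs HP HS) [LHS]mxE.
have addmxE (a b : 'M[R]_n) i j : (a + b) i j = a i j + b i j by rewrite mxE.
have submxE (a b : 'M[R]_n) i j : (a - b) i j = a i j - b i j by rewrite !mxE.
have E i j : (H x *m cov_end G i (B j) x) j i =
    (H x *m P i j x *m S x) j i - (H x *m P i j x *m S x) i j
    + ((H x *m N j x *m N i x) j i - (H x *m N i x *m N j x) j i).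
  rewrite cov_commutator//.
  have -> (a b c d : 'M[R]_n) : H x *m (a *m b + c *m d - (d *m c + b *m a)) =
      H x *m a *m b - H x *m b *m a + (H x *m c *m d - H x *m d *m c).
    by rewrite mulmxBr !mulmxDr !mulmxA [H x *m d *m _ + _]addrC opprD addrACA.
  by rewrite -HSP addmxE !submxE.
under eq_bigr => i _ do under eq_bigr => j _ do rewrite E.
have E' i j : (H x *m (P i j x - P j i x) *m S x) j i =
    (H x *m P i j x *m S x) j i - (H x *m P j i x *m S x) j i.
  by rewrite mulmxBr mulmxBl submxE.
under [RHS]eq_bigr => i _ do
  under eq_bigr => j _ do rewrite E' -[_ + _ - _]addrA.
under eq_bigr => i _ do rewrite big_split sumrB/=.
under [RHS]eq_bigr => i _ do rewrite big_split sumrB/=.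
rewrite [LHS]big_split [RHS]big_split/=; congr (_ + _); rewrite !sumrB.
(* Renaming [i] and [j] turns (H P_ij S)_ij into (H P_ji S)_ji. *)
by congr (_ - _); rewrite exchange_big.
Qed.

End Theta.

(** * The inner product at a point *)

Section Inner.
Context {R : realType} {n : nat}.
Variables (G : 'rV[R]_n -> 'M[R]_n) (x : 'rV[R]_n).
Implicit Types (u v : 'rV[R]_n).

Lemma innerZl a u v : inner G x (a *: u) v = a * inner G x u v.
Proof. by rewrite /inner -!scalemxAl mxE. Qed.

Lemma innerZr a u v : inner G x u (a *: v) = a * inner G x u v.
Proof. by rewrite /inner linearZ/= -scalemxAr mxE. Qed.

Lemma inner_suml (I : finType) (u : I -> 'rV[R]_n) v :
  inner G x (\sum_i u i) v = \sum_i inner G x (u i) v.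
Proof. by rewrite /inner !mulmx_suml summxE. Qed.

Lemma inner_sumr (I : finType) u (v : I -> 'rV[R]_n) :
  inner G x u (\sum_i v i) = \sum_i inner G x u (v i).
Proof. by rewrite /inner linear_sum/= mulmx_sumr summxE. Qed.

Lemma inner_sym u v : (G x)^T = G x -> inner G x u v = inner G x v u.
Proof.
move=> Gs; rewrite /inner.
have -> : v *m G x *m u^T = (u *m G x *m v^T)^T.
  by rewrite !trmx_mul trmxK Gs mulmxA.
by rewrite [RHS]mxE.
Qed.

Lemma innerB u v : (G x)^T = G x ->
  inner G x (u - v) (u - v) =
  inner G x u u + inner G x v v - 2 * inner G x u v.
Proof.
move=> Gs; have := inner_sym u v Gs.
rewrite /inner linearB/= mulmxBr !mulmxBl !mxE => ->.
by ring.
Qed.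

(** Self-adjointness moves [B] to the left of the metric, which then cancels against the inverse
    metric in the second row. *)
Lemma inner_rows A B i j : (G x)^T = G x -> G x \in unitmx ->
  B *m G x = G x *m B^T ->
  inner G x (row i (invmx (G x)) *m A) (row j (invmx (G x)) *m B) =
  (invmx (G x) *m A *m B) i j.
Proof.
move=> Gs Gu BG; rewrite /inner trmx_mul mulmxA -(mulmxA (row i _ *m A)) -BG.
rewrite -(mulmxA (row i _) A) row_mul_entry trmx_inv Gs.
by rewrite -!mulmxA mulmxV// mulmx1.
Qed.

End Inner.

(** * Frame traces and norms as contractions with the inverse metric *)

Section FrameTraces.
Context {R : realType} {n : nat}.
Local Notation vec := 'rV[R]_n.
Variables (G S : vec -> 'M[R]_n) (e : 'I_n -> vec -> vec) (x : vec).
Hypotheses (Gsym : (G x)^T = G x) (Gunit : G x \in unitmx).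
Hypotheses (de : forall k, diff2 (e k) x) (dS : diff2 S x).
Hypothesis (dA : forall i, diff1 (conn G i) x).
Hypothesis e_orth :
  forall i j, inner G x (e i x) (e j x) = (i == j)%:R.

Local Notation H := (invmx (G x)).
Local Notation N i := (cov_end G i S x).
Local Notation P i j := (cov_end G i (cov_end G j S) x).

Hypothesis SG : S x *m G x = G x *m (S x)^T.
Hypothesis NG : forall i, N i *m G x = G x *m (N i)^T.

Let frameE i (C : 'M[R]_n) : \sum_k e k x 0 i *: (e k x *m C) = row i H *m C.
Proof. by apply: (frame_sum (e := fun k => e k x)). Qed.

Lemma nablaS_frame k l :
  nablaS G S (e k) (e l) x = \sum_i e k x 0 i *: (e l x *m N i).
Proof. by rewrite nablaSE//; exact: diff2W. Qed.

(** Summing over the frame first gives div S as the sum of the vectors [row i H *m N i], whose inner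
    products are matrix entries. *)
Lemma normsq_divS : normsq G x (divS G S e x) =
  \sum_i \sum_j (H *m N j *m N i) j i.
Proof.
have -> : divS G S e x = \sum_i row i H *m N i.
  rewrite /divS; under eq_bigr => k _ do rewrite nablaS_frame.
  by rewrite exchange_big; apply: eq_bigr => i _; rewrite frameE.
rewrite /normsq inner_suml [RHS]exchange_big; apply: eq_bigr => i _.
by rewrite inner_sumr; apply: eq_bigr => j _; rewrite inner_rows.
Qed.

(** The entry (H N_i N_j)_ji is the inner product of [row j H *m N i] and [row i H *m N j];
    expanding both rows in the frame produces the two derivatives with their arguments exchanged. *)
Lemma sum_nablaS_transpose :
  \sum_k \sum_l inner G x (nablaS G S (e k) (e l) x)
                          (nablaS G S (e l) (e k) x) =
  \sum_i \sum_j (H *m N i *m N j) j i.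
Proof.
have -> : \sum_i \sum_j (H *m N i *m N j) j i = \sum_i \sum_j \sum_k \sum_l
    e k x 0 i * (e l x 0 j * inner G x (e l x *m N i) (e k x *m N j)).
  apply: eq_bigr => i _; apply: eq_bigr => j _.
  rewrite -(inner_rows _ _ _ Gsym Gunit (NG j)) -!frameE inner_sumr.
  apply: eq_bigr => k _; rewrite innerZr inner_suml mulr_sumr.
  by apply: eq_bigr => l _; rewrite innerZl.
under [RHS]eq_bigr => i _ do rewrite exchange_big/=.
rewrite [RHS]exchange_big/=; apply: eq_bigr => k _.
under [RHS]eq_bigr => i _ do rewrite exchange_big/=.
rewrite [RHS]exchange_big/=; apply: eq_bigr => l _.
rewrite !nablaS_frame inner_suml; apply: eq_bigr => i _.
rewrite innerZl inner_sumr mulr_sumr; apply: eq_bigr => j _.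
by rewrite innerZr.
Qed.

(** Expand |a - b|^2: after exchanging the frame indices both squares total |nabla S|^2, and the
    cross terms are [sum_nablaS_transpose]. *)
Lemma normsq_WE : 2^-1 * normsq_W G S e x =
  normsq_nablaS G S e x - \sum_i \sum_j (H *m N i *m N j) j i.
Proof.
rewrite -sum_nablaS_transpose.
have -> : normsq_W G S e x = normsq_nablaS G S e x + normsq_nablaS G S e x
    - 2 * \sum_k \sum_l inner G x (nablaS G S (e k) (e l) x)
                                  (nablaS G S (e l) (e k) x).
  rewrite {2}/normsq_nablaS exchange_big /normsq_W /normsq_nablaS/= mulr_sumr.
  rewrite -big_split -sumrB/=; apply: eq_bigr => k _.
  rewrite mulr_sumr -big_split -sumrB/=; apply: eq_bigr => l _.
  by rewrite /normsq /Wten innerB.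
lra.
Qed.

Lemma inner_TSE : inner_TS G S e x =
  \sum_i \sum_j (H *m (P i j - P j i) *m S x) j i.
Proof.
(* The trace over the frame becomes a row of H, and the sign in T reverses P_ij - P_ji. *)
have TE l : Top G S e (e l) x =
    \sum_j e l x 0 j *: \sum_i row i H *m (P j i - P i j).
  rewrite /Top; under eq_bigr => k _ do
    rewrite (RSE (diff2W (de k)) (diff2W (de l)) (de k) dS dA).
  rewrite exchange_big/=; under eq_bigr => i _ do rewrite exchange_big/=.
  rewrite exchange_big -sumrN/=; apply: eq_bigr => j _.
  rewrite scaler_sumr -sumrN; apply: eq_bigr => i _.
  rewrite -frameE scaler_sumr -sumrN; apply: eq_bigr => k _.
  by rewrite scalerA mulrC -scalerN -mulmxN opprB.
rewrite /inner_TS; under eq_bigr => l _ do rewrite TE inner_suml.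
rewrite exchange_big/= [RHS]exchange_big/=.
rewrite [RHS]exchange_big/=; apply: eq_bigr => j _.
(* The remaining frame sum over [l] is absorbed into the second argument, again as a row of H. *)
transitivity (inner G x (\sum_i row i H *m (P j i - P i j)) (row j H *m S x)).
  rewrite -frameE inner_sumr; apply: eq_bigr => l _.
  by rewrite innerZl innerZr.
by rewrite inner_suml; apply: eq_bigr => i _; rewrite inner_rows.
Qed.

End FrameTraces.

(** * From the manifold to a chart, and the divergence formula *)

Lemma posdef_unitmx (R : realType) n (A : 'M[R]_n) :
  (forall v : 'rV[R]_n, v != 0 -> 0 < (v *m A *m v^T) 0 0) -> A \in unitmx.
Proof.
move=> Apos; rewrite -row_free_unit -kermx_eq0.
apply/rowV0P => v /sub_kermxP vA.
by apply/eqP/negPn/negP => /Apos; rewrite vA mul0mx mxE ltxx.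
Qed.

Lemma symmetric_op_selfadjoint (R : realType) n (G S : 'rV[R]_n -> 'M[R]_n)
    D x :
  symmetric_op G S D -> D x -> S x *m G x = G x *m (S x)^T.
Proof.
move=> Ssym Dx; apply/matrixP => i j.
have := Ssym x Dx (row i 1%:M) (row j 1%:M); rewrite /inner trmx_mul mulmxA.
rewrite -(mulmxA _ (S x)) -(mulmxA _ (G x) (S x)^T) !row_mul_entry.
by rewrite !mul1mx !trmx1 !mulmx1.
Qed.

Theorem proposition4p1 (R : realType) (n : nat) (M : manifold R n)
    (g : riemannian_metric M) (S : tensor11 M)
    (S_sym : forall d, symmetric_op (g d) (S d) (chart_img d))
    (p : M) (c : chart M) (V : set 'rV[R]_n)
    (e : 'I_n -> 'rV[R]_n -> 'rV[R]_n)
    (pc : chart_dom c p) (V_open : open V) (Vp : V (chart_map c p))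
    (V_sub : V `<=` chart_img c)
    (e_frame : orthonormal_frame (g c) V e) :
  let x := chart_map c p in
  vdiv (g c) (theta (g c) (S c)) x =
    inner_TS (g c) (S c) e x
    + normsq (g c) x (divS (g c) (S c) e x)
    - normsq_nablaS (g c) (S c) e x
    + 2^-1 * normsq_W (g c) (S c) e x.
Proof.
move=> x; pose D := chart_img c; have Dx : D x by exact: V_sub.
have Dopen : open D := @chart_img_open _ _ M c.
have dG y : D y -> diff2 (g c) y.
  by move=> Dy; exact: smooth_diff2 Dopen Dy (metric_smooth g c).
have dS y : D y -> diff2 (S c) y.
  by move=> Dy; exact: smooth_diff2 Dopen Dy (tensor11_smooth S c).
have Gsym y : D y -> (g c y)^T = g c y by exact: Defs.metric_sym.
have Gunit y : D y -> g c y \in unitmx.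
  by move=> Dy; apply: posdef_unitmx => v; exact: (metric_pos g Dy).
have SG y : D y -> S c y *m g c y = g c y *m (S c y)^T.
  exact: symmetric_op_selfadjoint.
have [e_smooth e_orth] := e_frame.
have de k : diff2 (e k) x by exact: smooth_diff2 V_open Vp (e_smooth k).
have dA i : diff1 (conn (g c) i) x by exact: (diff1_conn_on Dopen dG Gunit).
have NG i := covS_selfadjoint Dopen dG dS Gsym Gunit SG i Dx.
rewrite (vdiv_theta Dopen dG dS Gsym Gunit SG Dx).
rewrite (inner_TSE (Gsym _ Dx) (Gunit _ Dx) de (dS _ Dx) dA (e_orth x Vp)
  (SG _ Dx)).
rewrite (normsq_divS (Gsym _ Dx) (Gunit _ Dx) de (dS _ Dx) (e_orth x Vp) NG).
rewrite (normsq_WE (Gsym _ Dx) (Gunit _ Dx) de (dS _ Dx) (e_orth x Vp) NG).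
(* The term |nabla S|^2 cancels against the one contained in half of |W|^2; what is left agrees with
   [vdiv_theta] term by term. *)
rewrite addrA subrK -big_split -sumrB/=; apply: eq_bigr => i _.
by rewrite -big_split -sumrB.
Qed.
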